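(* Let $\theta>0$ be a real number. Suppose that $|S_\theta(z_0,z_1,z_2)|\le 1$ for all $z_0\in\mathbb{R}$ and $z_1,z_2\in\mathbb{C}$ satisfying $$|z_0|\le 2\sqrt{\Re z_1\,\Re z_2},\qquad \Re z_1\le 0,\qquad \Re z_2\le 0.$$ Then $\theta\ge\frac25$.
   Context: For a real parameter $\theta>0$ and $z_0,z_1,z_2\in\mathbb{C}$ with $\Re z_1\le 0$, $\Re z_2\le 0$, set $z=z_1+z_2$ and $p=(1-\theta z_1)(1-\theta z_2)$ (which is nonzero), and define $$S_\theta(z_0,z_1,z_2)=1+\frac{z_0+z}{p}+\theta\,\frac{z_0(z_0+z)}{p^2}+\left(\tfrac12-\theta\right)\frac{(z_0+z)^2}{p^2}.$$ This is the stability function of the Modified Craig--Sneyd (MCS) scheme with parameter $\theta$ applied to the scalar test equation $U'(t)=(\lambda_0+\lambda_1+\lambda_2)U(t)$ with $z_j=\Delta t\,\lambda_j$. *)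

(* Defs.v *)
From Stdlib Require Import Reals Lra.
From Coquelicot Require Import Coquelicot.

Open Scope R_scope.

Definition mcs_p (theta : R) (z1 z2 : C) : C :=
  ((1 - RtoC theta * z1) * (1 - RtoC theta * z2))%C.

(* Stability function of the Modified Craig--Sneyd scheme with parameter
   [theta], for the test equation U' = (lambda0 + lambda1 + lambda2) U with
   zj = Delta t * lambdaj. *)
Definition mcs_S (theta : R) (z0 z1 z2 : C) : C :=
  let z := (z1 + z2)%C in
  let p := mcs_p theta z1 z2 in
  (1 + (z0 + z) / p
     + RtoC theta * (z0 * (z0 + z) / p ^ 2)
     + RtoC (1 / 2 - theta) * ((z0 + z) ^ 2 / p ^ 2))%C.

(* Division in [C] is total, so [mcs_S] is meaningful only where [mcs_p] does
   not vanish; this covers the closed left half-planes. *)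
Lemma mcs_p_neq0 (theta : R) (z1 z2 : C) :
  0 < theta -> Re z1 <= 0 -> Re z2 <= 0 -> mcs_p theta z1 z2 <> RtoC 0.
Proof.
  assert (H : forall z : C, 0 < theta -> Re z <= 0 ->
    (1 - RtoC theta * z)%C <> RtoC 0).
  { intros [x y] Ht Hx E. apply (f_equal fst) in E. simpl in *. nra. }
  intros Ht H1 H2. apply Cmult_neq_0; now apply H.
Qed.

(* Main.v *)
(* For theta < 2/5 a violation occurs near the origin, where S is close to 1.
   Take z1 = z2 = -x + ix and z0 = 2x with x > 0, so that |z0| attains the
   admissible bound and z0 + z1 + z2 = 2ix is purely imaginary.  Then
     |p^2 S|^2 - |p|^4 = x^3 (8 theta (2 - 5 theta) + O(x)),
   whose leading coefficient is positive exactly when theta < 2/5. *)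
Require Import Defs.
From Stdlib Require Import Reals Lra.
From Coquelicot Require Import Coquelicot.

Open Scope R_scope.

(** The numerator of [mcs_S] over the common denominator [p ^ 2], a polynomial in its arguments. *)
Definition mcs_num (theta : R) (z0 z1 z2 : C) : C :=
  let w := (z0 + (z1 + z2))%C in
  let p := mcs_p theta z1 z2 in
  (p ^ 2 + w * p + RtoC theta * (z0 * w) + RtoC (1 / 2 - theta) * w ^ 2)%C.

Lemma mcs_S_mul_p2 (theta : R) (z0 z1 z2 : C) :
  mcs_p theta z1 z2 <> RtoC 0 ->
  (mcs_S theta z0 z1 z2 * mcs_p theta z1 z2 ^ 2)%C = mcs_num theta z0 z1 z2.
Proof.
  intros Hp. unfold mcs_S, mcs_num. cbv zeta. now field.
Qed.

Lemma Cmod_sqr (z : C) : Cmod z ^ 2 = Re z ^ 2 + Im z ^ 2.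
Proof.
  unfold Cmod, Re, Im. rewrite pow2_sqrt; [reflexivity | nra].
Qed.

(** Multiplying $|S|^2\le 1$ by $|p|^4$ leaves a real polynomial inequality, free of division and
    square roots. *)
Lemma mcs_num_le (theta : R) (z0 z1 z2 : C) :
  mcs_p theta z1 z2 <> RtoC 0 ->
  Cmod (mcs_S theta z0 z1 z2) <= 1 ->
  Re (mcs_num theta z0 z1 z2) ^ 2 + Im (mcs_num theta z0 z1 z2) ^ 2
  <= (Re (mcs_p theta z1 z2) ^ 2 + Im (mcs_p theta z1 z2) ^ 2) ^ 2.
Proof.
  intros Hp HS.
  rewrite <- !Cmod_sqr, <- (mcs_S_mul_p2 _ _ _ _ Hp), Cmod_mult, Cmod_pow, Rpow_mult_distr.
  rewrite <- (Rmult_1_l ((Cmod _ ^ 2) ^ 2)) at 2.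
  apply Rmult_le_compat_r; [apply pow2_ge_0 |].
  rewrite <- (pow1 2). apply pow_incr. split; [apply Cmod_ge_0 | exact HS].
Qed.

Definition defect_remainder (t x : R) : R :=
  4 - 32 * t + 128 * t ^ 2 - 192 * t ^ 3
  + x * (- 16 * t ^ 2 + 96 * t ^ 3 - 256 * t ^ 4)
  + x ^ 2 * (32 * t ^ 4 - 128 * t ^ 5) - 32 * x ^ 3 * t ^ 6.

(** No power of [x] below the third survives because the scheme has order two: with $w=2ix$,
    $S=1+w+w^2/2+O(x^3)$, and $|1+w+w^2/2|^2=1+4x^4$ for this imaginary $w$. *)
Lemma mcs_defect (t x : R) :
  let z := (- x, x) in
  Re (mcs_num t (RtoC (2 * x)) z z) ^ 2 + Im (mcs_num t (RtoC (2 * x)) z z) ^ 2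
  - (Re (mcs_p t z z) ^ 2 + Im (mcs_p t z z) ^ 2) ^ 2
  = x ^ 3 * (8 * t * (2 - 5 * t) + x * defect_remainder t x).
Proof.
  unfold defect_remainder, mcs_num, mcs_p, Re, Im. simpl. field.
Qed.

(** A crude bound, uniform in [t] and [x], from estimating the powers of [t] by those of 2/5 and the
    powers of [x] by 1. Any constant above -80 suffices for the choice of [x] in the theorem. *)
Lemma defect_remainder_gt (t x : R) :
  0 < t < 2 / 5 -> 0 < x <= 1 -> - 50 < defect_remainder t x.
Proof.
  intros Ht Hx. unfold defect_remainder.
  assert (H2 : 0 < t ^ 2 < 4 / 25) by nra.
  assert (H3 : 0 < t ^ 3 < 8 / 125) by (replace (t ^ 3) with (t * t ^ 2) by ring; nra).
  assert (H4 : 0 < t ^ 4 < 16 / 625) by (replace (t ^ 4) with (t * t ^ 3) by ring; nra).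
  assert (H5 : 0 < t ^ 5 < 32 / 3125) by (replace (t ^ 5) with (t * t ^ 4) by ring; nra).
  assert (H6 : 0 < t ^ 6 < 64 / 15625) by (replace (t ^ 6) with (t * t ^ 5) by ring; nra).
  assert (X2 : 0 < x ^ 2 <= 1) by nra.
  assert (X3 : 0 < x ^ 3 <= 1) by (replace (x ^ 3) with (x * x ^ 2) by ring; nra).
  assert (B1 : - 10 <= x * (- 16 * t ^ 2 + 96 * t ^ 3 - 256 * t ^ 4)) by nra.
  assert (B2 : - 2 <= x ^ 2 * (32 * t ^ 4 - 128 * t ^ 5)) by nra.
  assert (B3 : x ^ 3 * t ^ 6 <= 1) by nra.
  nra.
Qed.

Theorem theorem3 :
  forall theta : R,
    0 < theta ->
    (forall (z0 : R) (z1 z2 : C),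
        Rabs z0 <= 2 * sqrt (Re z1 * Re z2) ->
        Re z1 <= 0 ->
        Re z2 <= 0 ->
        Cmod (mcs_S theta (RtoC z0) z1 z2) <= 1) ->
    2 / 5 <= theta.
Proof.
  intros t Ht H. destruct (Rle_or_lt (2 / 5) t) as [Hle | Hlt]; [exact Hle | exfalso].
  (* Scaled so that the leading coefficient [8 * t * (2 - 5 * t)] equals [80 * x]; the bracket in
     [mcs_defect] is then [x * (80 + defect_remainder t x)], which exceeds [30 * x]. *)
  set (x := t * (2 - 5 * t) / 10).
  assert (Hx : 0 < x <= 1) by (unfold x; nra).
  set (z := (- x, x) : C).
  assert (Hz : Re z <= 0) by (unfold z; simpl; lra).
  assert (H0 : Rabs (2 * x) <= 2 * sqrt (Re z * Re z)).
  { rewrite Rabs_pos_eq by lra. unfold z; simpl.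
    replace (- x * - x) with (x * x) by ring. rewrite sqrt_square; lra. }
  pose proof (mcs_num_le t _ z z (mcs_p_neq0 t z z Ht Hz Hz) (H _ z z H0 Hz Hz)) as Hnum.
  pose proof (mcs_defect t x) as Hdef. cbv zeta in Hdef. fold z in Hdef.
  pose proof (defect_remainder_gt t x (conj Ht Hlt) Hx) as Hrem.
  assert (Hpos : 0 < 8 * t * (2 - 5 * t) + x * defect_remainder t x).
  { replace (8 * t * (2 - 5 * t)) with (80 * x) by (unfold x; field). nra. }
  assert (0 < x ^ 3 * (8 * t * (2 - 5 * t) + x * defect_remainder t x))
    by (apply Rmult_lt_0_compat; [apply pow_lt; lra | exact Hpos]).
  lra.
Qed.
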